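(* Let $S$ be a finite set of points in $\mathbb{R}^d$ and $z \in \mathbb{R}^d \setminus S$. Suppose that $S$ is $z$-containing, $z$ is in general position with respect to $S$, and $|S| \ge d+2$. Then $|\mathcal{A}(S)| \le d\,|\mathcal{C}(S)| - |S| + 3$.
   Context: For $X \subseteq S$, $\mathrm{conv}(X)$ is the convex hull and $R(X)$ the smallest affine subspace containing $X$. A set $X \subseteq S$ is $z$-containing if $z$ lies in the interior of $\mathrm{conv}(X)$, and $z$-avoiding otherwise. $\mathcal{C}(S)$ is the set of minimal (under inclusion) $z$-containing subsets of $S$, and $\mathcal{A}(S)$ is the set of maximal (under inclusion, among subsets of $S$) $z$-avoiding subsets of $S$. The point $z$ is in general position with respect to $S$ if for every $X \subseteq S$ with $\dim R(X) < d$ we have $z \notin R(X)$. *)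

(* Defs.v *)
From HB Require Import structures.
From mathcomp Require Import all_boot all_order all_algebra finmap.
From mathcomp Require Import all_classical all_reals all_analysis.

Set Implicit Arguments.
Unset Strict Implicit.
Unset Printing Implicit Defensive.

Import Order.TTheory GRing.Theory Num.Theory.
Import numFieldNormedType.Exports.

Local Open Scope classical_set_scope.
Local Open Scope ring_scope.

Section Defs.
Variables (R : realType) (d : nat).
Implicit Types (A : set 'rV[R]_d) (p z : 'rV[R]_d) (V : {vspace 'rV[R]_d}).
Implicit Types (S X Y : {fset 'rV[R]_d}).

Definition convex_hull A : set 'rV[R]_d :=
  smallest (@convex_set R 'rV[R]_d) A.

Definition translate p V : set 'rV[R]_d := [set p + v | v in [set` V]].

(* The empty set counts as an affine subspace, so that the affine hull of the *)
(* empty set is empty.                                                        *)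
Definition affine_subspace A := A = set0 \/ exists p V, A = translate p V.

Definition affine_hull A : set 'rV[R]_d := smallest affine_subspace A.

(* By convention the dimension of the empty affine subspace is -1; the value  *)
(* at sets that are not affine subspaces is irrelevant.                       *)
Definition affine_dim A : int :=
  xget (-1) [set k | exists p V, A = translate p V /\ k = (\dim V)%:Z].

Definition z_containing z X : Prop := interior (convex_hull [set` X]) z.

Definition z_avoiding z X : Prop := ~ z_containing z X.

Definition min_containing z S : {fset {fset 'rV[R]_d}} :=
  [fset X in fpowerset S | `[< z_containing z X /\
     forall Y, (Y `<=` S)%fset -> z_containing z Y -> (Y `<=` X)%fset ->
     Y = X >]]%fset.

Definition max_avoiding z S : {fset {fset 'rV[R]_d}} :=
  [fset X in fpowerset S | `[< z_avoiding z X /\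
     forall Y, (Y `<=` S)%fset -> z_avoiding z Y -> (X `<=` Y)%fset ->
     Y = X >]]%fset.

Definition general_position z S : Prop :=
  forall X, (X `<=` S)%fset -> affine_dim (affine_hull [set` X]) < d%:Z ->
  ~ affine_hull [set` X] z.

Lemma mem_translate p V x : translate p V x <-> x - p \in V.
Proof.
split=> [[v /= vV <-]|xV]; first by rewrite addrC addKr.
by exists (x - p); rewrite //= addrC subrK.
Qed.

Lemma translate_eq p q V : translate p V q -> translate p V = translate q V.
Proof.
move=> /mem_translate qV; apply/seteqP; split=> x /mem_translate xV;
  apply/mem_translate.
- have -> : x - q = (x - p) - (q - p) by rewrite opprB addrA subrK.
  exact: memvB.
- have -> : x - p = (x - q) + (q - p) by rewrite addrA subrK.
  exact: memvD.
Qed.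

Lemma affine_dim0 : affine_dim set0 = -1.
Proof.
rewrite /affine_dim; case: xgetP => // k _ [p [V [E _]]].
suff : (set0 : set 'rV[R]_d) p by [].
by rewrite E; apply/mem_translate; rewrite subrr mem0v.
Qed.

Lemma affine_dim_translate p V : affine_dim (translate p V) = (\dim V)%:Z.
Proof.
rewrite /affine_dim; case: xgetP => [k _ [q [W [E ->]]]|/(_ (\dim V)%:Z) []];
  last by exists p, V.
suff -> : V = W by [].
have : translate p V q by rewrite E; apply/mem_translate; rewrite subrr mem0v.
move=> /translate_eq E'; apply/vspaceP => v.
have : translate q V (q + v) <-> translate q W (q + v) by rewrite -E' -E.
rewrite !mem_translate addrC addKr => - [VW WV].
by apply/idP/idP.
Qed.

Lemma affine_hull_affine A : affine_subspace (affine_hull A).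
Proof.
have [[q hq]|/forallNP h0] := pselect (exists q, affine_hull A q); last first.
  by left; apply/seteqP; split=> x // /h0.
right.
pose P (k : nat) := exists V, \dim V = k /\ A `<=` translate q V.
have exP : exists k, `[< P k >].
  exists (\dim {: 'rV[R]_d}); apply/asboolP; exists fullv; split=> //.
  by move=> x _; apply/mem_translate; rewrite memvf.
case: (ex_minnP exP) => k /asboolP[V [dV AV]] kmin.
exists q, V; apply/seteqP; split=> x.
  by apply; split=> //; right; exists q, V.
move=> xV B [[->|[p [W ->]]] AW].
  by have [] := hq set0; split=> //; left.
have qW : translate p W q by apply: hq; split=> //; right; exists p, W.
rewrite (translate_eq qW) in AW *.
have AVW : A `<=` translate q (V :&: W)%VS.
  move=> y Ay; apply/mem_translate; rewrite memv_cap.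
  by apply/andP; split; apply/mem_translate; [exact: AV|exact: AW].
have : (k <= \dim (V :&: W))%N.
  by apply: kmin; apply/asboolP; exists (V :&: W)%VS.
rewrite -dV => dVW; have /eqP VE : (V :&: W)%VS == V.
  by rewrite eqEdim capvSl.
apply/mem_translate; move/mem_translate: xV.
by rewrite -{1}VE memv_cap => /andP[].
Qed.

End Defs.

(* Main.v *)
Require Import Defs.
From mathcomp Require Import all_boot all_order all_algebra finmap.
From mathcomp Require Import all_classical all_reals all_analysis.
From mathcomp Require Import zify ring lra.
Import Order.TTheory GRing.Theory Num.Theory.
Import numFieldNormedType.Exports.
Local Open Scope ring_scope.

(* Write [A S] and [C S] for the maximal avoiding and minimal containing      *)
(* subsets and [n] for the size of [S]. Induction on [n] gives the stronger   *)
(* bound [|A S| + d (n - d) <= d + 1 + d |C S|]. If deleting [p] leaves a     *)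
(* containing set, the members of [A S] that do not restrict to members of    *)
(* [A (S - p)] are half-spaces whose bounding hyperplane passes through a     *)
(* simplex of [C S] with vertex [p], minus [p] and one further vertex [y]:    *)
(* this is linear programming duality applied to the functionals that are     *)
(* nonnegative on the avoiding set. Such a set is determined by the simplex   *)
(* and [y], and one of the simplices through [p] never occurs, so there are   *)
(* at most [d (k - 1)] of them when [k] simplices contain [p].                *)

Set Implicit Arguments.
Unset Strict Implicit.
Unset Printing Implicit Defensive.

(** With [z] as origin and [d > 0], general position makes a subset of [S] containing exactly when
    no linear form is positive on all of it ([z_containingP]); a nonzero form that is only
    nonnegative on it can be tilted to a positive one. The problem thus concerns signs of forms on
    [S], and the minimal containing sets are simplices with [d + 1] vertices ([containing_card_ge],
    [min_containing_card_le]).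

    Let the deletion of [p] leave a containing set, and let [k] simplices pass through [p]. Deletion
    destroys exactly these [k]. Restriction to [S - p] is injective on maximal avoiding sets, and a
    set whose restriction stops being maximal is charged to a simplex through [p] and another of its
    vertices ([new_max_avoiding]). One simplex is never charged ([unused_simplex]), so [|A|] drops
    by at most [d (k - 1)] while [d |C|] drops by [d k]; the difference [d] pays for the deleted
    point. If no deletion is possible, [S] is itself a simplex. *)

(** * The dot product on row vectors *)

Section Dot.
Variables (R : realFieldType) (n : nat).
Implicit Types (u v x y : 'rV[R]_n).

Definition dot v x : R := \sum_i v 0 i * x 0 i.

Lemma dotC v x : dot v x = dot x v.
Proof. by apply: eq_bigr => i _; rewrite mulrC. Qed.

Lemma dotDl u v x : dot (u + v) x = dot u x + dot v x.
Proof. by rewrite -big_split; apply: eq_bigr => i _; rewrite mxE mulrDl. Qed.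

Lemma dotZl c v x : dot (c *: v) x = c * dot v x.
Proof. by rewrite /dot mulr_sumr; apply: eq_bigr => i _; rewrite mxE mulrA. Qed.

Lemma dotDr v x y : dot v (x + y) = dot v x + dot v y.
Proof. by rewrite dotC dotDl !(dotC v). Qed.

Lemma dotZr c v x : dot v (c *: x) = c * dot v x.
Proof. by rewrite dotC dotZl (dotC v). Qed.

Lemma dot0l x : dot 0 x = 0.
Proof. by rewrite -[in LHS](scale0r x) dotZl mul0r. Qed.

Lemma dot0r v : dot v 0 = 0.
Proof. by rewrite dotC dot0l. Qed.

Lemma dotNl v x : dot (- v) x = - dot v x.
Proof. by rewrite -scaleN1r dotZl mulN1r. Qed.

Lemma dotNr v x : dot v (- x) = - dot v x.
Proof. by rewrite dotC dotNl dotC. Qed.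

Lemma dot_suml (I : Type) (r : seq I) (P : pred I) (F : I -> 'rV[R]_n) x :
  dot (\sum_(i <- r | P i) F i) x = \sum_(i <- r | P i) dot (F i) x.
Proof. by elim/big_rec2: _ => [|i a b _ <-]; rewrite ?dot0l ?dotDl. Qed.

Lemma dot_self_eq0 v : dot v v = 0 -> v = 0.
Proof.
move=> /eqP; rewrite /dot psumr_eq0 => [/allP h|i _]; last exact: sqr_ge0.
apply/rowP => i; rewrite mxE; apply/eqP.
by rewrite -[_ == _]orbb -mulf_eq0; apply: (h i); rewrite mem_index_enum.
Qed.

End Dot.

(** * Motzkin's transposition theorem for strict and weak homogeneous inequalities *)

Section Motzkin.
Variable R : realFieldType.

Definition pos_if (b : bool) (r : R) := if b then 0 < r else 0 <= r.

(* The flag records whether some strict constraint enters the combination. *)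
Inductive mixed_cone n (s : seq (bool * 'rV[R]_n)) : bool -> 'rV[R]_n -> Prop :=
| mixed_cone0 : mixed_cone s false 0
| mixed_cone_mem b x : (b, x) \in s -> mixed_cone s b x
| mixed_coneD b c x y :
    mixed_cone s b x -> mixed_cone s c y -> mixed_cone s (b || c) (x + y)
| mixed_coneZ k b x : 0 < k -> mixed_cone s b x -> mixed_cone s b (k *: x).

Definition bound_lt (l u : bool * R) := pos_if (l.1 || u.1) (u.2 - l.2).

Lemma seq_argmax (T : eqType) (f : T -> R) (s : seq T) : s != [::] ->
  exists2 m, m \in s & forall x, x \in s -> f x <= f m.
Proof.
elim: s => // a s IH _; have [->|/IH[m ms mmax]] := eqVneq s [::].
  by exists a; rewrite ?mem_head// => x; rewrite inE => /eqP->.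
have [am|/ltW ma] := leP (f a) (f m).
  exists m; rewrite ?inE ?ms ?orbT// => x.
  by rewrite inE => /predU1P[->//|/mmax].
exists a; rewrite ?mem_head// => x; rewrite inE => /predU1P[->//|/mmax].
by move=> /le_trans; apply.
Qed.

Lemma seq_argmin (T : eqType) (f : T -> R) (s : seq T) : s != [::] ->
  exists2 m, m \in s & forall x, x \in s -> f m <= f x.
Proof.
move=> /(seq_argmax (fun x => - f x))[m ms mmin]; exists m => // x /mmin.
by rewrite lerN2.
Qed.

(** The midpoint of the largest lower and the smallest upper bound works: where it touches a bound
    the two extremes coincide, and comparing that bound with the opposite extreme shows that it is
    not strict. *)
Lemma interpolate (L U : seq (bool * R)) :
    (forall l u, l \in L -> u \in U -> bound_lt l u) ->
  exists t, (forall l, l \in L -> pos_if l.1 (t - l.2)) /\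
            (forall u, u \in U -> pos_if u.1 (u.2 - t)).
Proof.
move=> LU; have [->|/(seq_argmax snd)[m mL mmax]] := eqVneq L [::].
  have [->|/(seq_argmin snd)[M MU Mmin]] := eqVneq U [::]; first by exists 0.
  exists (M.2 - 1); split=> // u /Mmin uM.
  by case: u uM => -[] /= u uM; lra.
have [->|/(seq_argmin snd)[M MU Mmin]] := eqVneq U [::].
  exists (m.2 + 1); split=> // l /mmax lm.
  by case: l lm => -[] /= l lm; lra.
have mM : m.2 <= M.2.
  by have := LU _ _ mL MU; rewrite /bound_lt; case: (_ || _) => /=; lra.
exists ((m.2 + M.2) / 2); split.
  move=> l lL; have lm := mmax _ lL; have := LU _ _ lL MU.
  by case: l lm {lL} => -[] /= l lm; rewrite /bound_lt/=; lra.
move=> u uU; have uM := Mmin _ uU; have := LU _ _ mL uU.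
by case: u uM {uU} => -[] /= u uM; rewrite /bound_lt/= ?orbT /=; lra.
Qed.

Definition row_tail n (x : 'rV[R]_n.+1) : 'rV[R]_n := \row_j x 0 (lift ord0 j).

Lemma dot_recl n (v x : 'rV[R]_n.+1) :
  dot v x = v 0 0 * x 0 0 + dot (row_tail v) (row_tail x).
Proof.
rewrite /dot big_ord_recl; congr (_ + _).
by apply: eq_bigr => i _; rewrite !mxE.
Qed.

Lemma row_tail_eq0 n (x : 'rV[R]_n.+1) : x 0 0 = 0 -> row_tail x = 0 -> x = 0.
Proof.
move=> x0 /rowP tx; apply/rowP => i; rewrite mxE.
by case: (unliftP ord0 i) => [j ->|-> //]; have := tx j; rewrite !mxE.
Qed.

(** Meant for [a] with positive and [b] with negative first coordinate: a positive combination in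
    which that coordinate cancels. *)
Definition fm_pair n (a b : bool * 'rV[R]_n.+1) : bool * 'rV[R]_n.+1 :=
  (a.1 || b.1, a.2 0 0 *: b.2 + (- b.2 0 0) *: a.2).

Definition fm_elim n (s : seq (bool * 'rV[R]_n.+1)) :=
  [seq a : bool * 'rV[R]_n.+1 <- s | a.2 0 0 == 0] ++
  [seq fm_pair a b | a <- [seq a : bool * 'rV[R]_n.+1 <- s | 0 < a.2 0 0],
                     b <- [seq b : bool * 'rV[R]_n.+1 <- s | b.2 0 0 < 0]].

Lemma fm_elim_cone n (s : seq (bool * 'rV[R]_n.+1)) a :
  a \in fm_elim s -> mixed_cone s a.1 a.2 /\ a.2 0 0 = 0.
Proof.
rewrite mem_cat => /orP[|/allpairsP[[x y]/= []]].
  rewrite mem_filter => /andP[/eqP -> ain]; split=> //.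
  by apply: mixed_cone_mem; case: a ain.
rewrite !mem_filter => /andP[x0 xs] /andP[y0 ys] ->; split; last first.
  by rewrite /= !mxE mulNr [X in X - _]mulrC subrr.
rewrite /= orbC; apply: mixed_coneD; apply: mixed_coneZ; rewrite ?oppr_gt0 //.
  by apply: mixed_cone_mem; case: y ys {y0}.
by apply: mixed_cone_mem; case: x xs {x0}.
Qed.

Lemma mixed_cone_lift n (s : seq (bool * 'rV[R]_n.+1)) b y :
    mixed_cone [seq (a.1, row_tail a.2) | a : bool * 'rV[R]_n.+1 <- fm_elim s] b y ->
  exists x, [/\ mixed_cone s b x, x 0 0 = 0 & row_tail x = y].
Proof.
elim=> {b y} [|b y /mapP[a /fm_elim_cone[sa a0] [-> ->]]
  |b c x y _ [x' [sx x0 <-]] _ [y' [sy y0 <-]]|k b x k0 _ [x' [sx x0 <-]]].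
- exists 0; split; rewrite ?mxE//; first exact: mixed_cone0.
  by apply/rowP => j; rewrite !mxE.
- by exists a.2.
- exists (x' + y'); split; first exact: mixed_coneD.
    by rewrite mxE x0 y0 addr0.
  by apply/rowP => j; rewrite !mxE.
- exists (k *: x'); split; first exact: mixed_coneZ.
    by rewrite mxE x0 mulr0.
  by apply/rowP => j; rewrite !mxE.
Qed.

(* By Fourier-Motzkin elimination of the first coordinate. *)
Theorem motzkin n (s : seq (bool * 'rV[R]_n)) :
  (exists v, forall b x, (b, x) \in s -> pos_if b (dot v x)) \/
  mixed_cone s true 0.
Proof.
elim: n s => [|n IH] s.
  have [/hasP[[b x] xs /= b1]|/hasPn ns] := boolP (has fst s).
    right; rewrite (_ : 0 = x); last by apply/rowP => -[].
    by rewrite -b1; apply: mixed_cone_mem.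
  left; exists 0 => b x /ns /= /negPf ->.
  by rewrite /= dot0l.
have [[v vP]|] := IH [seq (a.1, row_tail a.2) | a : bool * 'rV[R]_n.+1 <- fm_elim s]; last first.
  by move=> /mixed_cone_lift[x [sx x0 /(row_tail_eq0 x0) x00]]; right; rewrite -x00.
(* Each constraint is solved for the missing coordinate of the form: a lower bound if its leading
   entry is positive, an upper bound if negative. *)
left; pose bd (a : bool * 'rV[R]_n.+1) := (a.1, - dot v (row_tail a.2) / a.2 0 0).
have [] := @interpolate [seq bd a | a : bool * 'rV[R]_n.+1 <- s & 0 < a.2 0 0]
                        [seq bd a | a : bool * 'rV[R]_n.+1 <- s & a.2 0 0 < 0].
  move=> l u /mapP[a aP ->] /mapP[b bP ->].
  have /vP : ((fm_pair a b).1, row_tail (fm_pair a b).2)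
      \in [seq (a.1, row_tail a.2) | a : bool * 'rV[R]_n.+1 <- fm_elim s].
    apply: (map_f (fun a : bool * 'rV_n.+1 => (a.1, row_tail a.2))).
    by rewrite mem_cat; apply/orP; right; apply/allpairsP; exists (a, b).
  have -> : row_tail (fm_pair a b).2 = a.2 0 0 *: row_tail b.2 + - b.2 0 0 *: row_tail a.2.
    by apply/rowP => j; rewrite !mxE.
  rewrite dotDr !dotZr /bound_lt /=.
  move: aP bP; rewrite !mem_filter => /andP[a0 _] /andP[b0 _].
  set A := dot v _; set B := dot v _.
  have -> : - A / b.2 0 0 - - B / a.2 0 0 =
      (a.2 0 0 * A + - b.2 0 0 * B) / (a.2 0 0 * - b.2 0 0).
    by field; rewrite (lt_eqF b0) (gt_eqF a0).
  have ab0 : 0 < a.2 0 0 * - b.2 0 0 by rewrite mulr_gt0 ?oppr_gt0.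
  by case: (_ || _) => /= h; rewrite ?divr_gt0 ?divr_ge0// ltW.
move=> t [tL tU]; exists (\row_j oapp (fun k => v 0 k) t (unlift ord0 j)).
move=> b x xs; rewrite dot_recl !mxE unlift_none /=.
set w := row_tail _; have {w}-> : w = v by apply/rowP => j; rewrite !mxE liftK.
have [x0|x0|x0] := ltgtP (x 0 0) 0.
- have /tU/= : bd (b, x) \in [seq bd a | a : bool * 'rV[R]_n.+1 <- s & a.2 0 0 < 0].
    by apply: map_f; rewrite mem_filter /= x0.
  have -> : t * x 0 0 + dot v (row_tail x) =
      - x 0 0 * (- dot v (row_tail x) / x 0 0 - t).
    by field; rewrite (lt_eqF x0).
  have nx0 : 0 < - x 0 0 by rewrite oppr_gt0.
  by case: b {xs} => /= h; rewrite ?mulr_gt0 ?mulr_ge0// ltW.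
- have /tL/= : bd (b, x) \in [seq bd a | a : bool * 'rV[R]_n.+1 <- s & 0 < a.2 0 0].
    by apply: map_f; rewrite mem_filter /= x0.
  have -> : t * x 0 0 + dot v (row_tail x) =
      x 0 0 * (t - - dot v (row_tail x) / x 0 0).
    by field; rewrite (gt_eqF x0).
  by case: b {xs} => /= h; rewrite ?mulr_gt0 ?mulr_ge0// ltW.
- rewrite x0 mulr0 add0r; apply: vP.
  apply: (map_f (fun a : bool * 'rV_n.+1 => (a.1, row_tail a.2)) (x := (b, x))).
  by rewrite mem_cat mem_filter /= x0 eqxx xs.
Qed.

End Motzkin.

(** * Linear dependence from rank *)

Lemma exists_left_kernel (F : fieldType) m n (A : 'M[F]_(m, n)) :
  (\rank A < m)%N -> exists2 k : 'rV[F]_m, k != 0 & k *m A = 0.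
Proof.
move=> rA; have : kermx A != 0 by rewrite -mxrank_eq0 mxrank_ker subn_eq0 -ltnNge.
move=> /rowV0Pn[k kA k0]; exists k => //.
by apply/eqP; rewrite -sub_kermx.
Qed.

Lemma linear_dependence (F : fieldType) d (T : finType) (f : T -> 'rV[F]_d) :
    (d < #|T|)%N ->
  exists mu : T -> F, (exists t, mu t != 0) /\ \sum_t mu t *: f t = 0.
Proof.
move=> dT; pose A := \matrix_(i < #|T|) f (enum_val i).
have [|k k0 kA] := @exists_left_kernel _ _ _ A; first exact: leq_ltn_trans (rank_leq_col _) dT.
exists (fun t => k 0 (enum_rank t)); split.
  by have /rV0Pn[i ki] := k0; exists (enum_val i); rewrite enum_valK.
rewrite (reindex (@enum_val T predT)) /=; last exact: onW_bij (enum_val_bij _).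
rewrite -[RHS]kA mulmx_sum_row; apply: eq_bigr => i _.
by rewrite enum_valK rowK.
Qed.

(** * Forms vanishing at [z], tilting, and the size of minimal containing sets *)

Section Separation.
Variables (R : realType) (d : nat) (z : 'rV[R]_d).
Implicit Types (u v w x y p : 'rV[R]_d) (S X Y B C : {fset 'rV[R]_d}).
Local Open Scope fset_scope.
Local Open Scope ring_scope.

Definition ev v x : R := dot v (x - z).

Lemma evD u v x : ev (u + v) x = ev u x + ev v x. Proof. exact: dotDl. Qed.
Lemma evZ c v x : ev (c *: v) x = c * ev v x. Proof. exact: dotZl. Qed.
Lemma evN v x : ev (- v) x = - ev v x. Proof. exact: dotNl. Qed.
Lemma ev0 x : ev 0 x = 0. Proof. exact: dot0l. Qed.

Lemma ev_eq1_neq0 v x : ev v x = 1 -> v != 0.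
Proof. by apply: contra_eq_neq => ->; rewrite ev0 eq_sym oner_eq0. Qed.

(** The linear substitute for [z_avoiding]. It holds vacuously for the empty set, also with
    [v = 0]. *)
Definition avoid X := exists v, forall x, x \in X -> 0 < ev v x.

(* The only consequence of general position that the combinatorics needs: a *)
(* closed half-space bounded by a hyperplane through [z] can be tilted to an *)
(* open one without losing points of [S].                                    *)
Definition tiltable S := forall v, v != 0 ->
  exists u, forall s, s \in S -> 0 <= ev v s -> 0 < ev u s.

Lemma avoidS X Y : X `<=` Y -> avoid Y -> avoid X.
Proof. by move=> /fsubsetP XY [v vY]; exists v => x /XY /vY. Qed.

Lemma tiltable_avoid S X v : tiltable S -> X `<=` S -> v != 0 ->
  (forall x, x \in X -> 0 <= ev v x) -> avoid X.
Proof.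
move=> tS /fsubsetP XS /tS[u uP] vX; exists u => x xX.
by apply: uP; [exact: XS|exact: vX].
Qed.

Lemma small_perturbation u v (s : seq 'rV[R]_d) :
  exists2 e, 0 < e & forall x, x \in s -> 0 < ev v x -> 0 < ev (v + e *: u) x.
Proof.
(* Asking for all smaller [e'] lets the induction pass to a minimum. *)
suff [e e0 eP] : exists2 e, 0 < e & forall e', 0 < e' -> e' <= e ->
    forall x, x \in s -> 0 < ev v x -> 0 < ev (v + e' *: u) x.
  by exists e => // x; exact: eP.
elim: s => [|a s [e e0 eP]]; first by exists 1.
pose ea := if 0 < ev v a then ev v a / (1 + `|ev u a|) else 1.
have na : 0 < 1 + `|ev u a| by rewrite ltr_wpDr.
have ea0 : 0 < ea by rewrite /ea; case: ifP => // va; rewrite divr_gt0.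
exists (Num.min e ea) => [|e' e'0]; first by rewrite lt_min e0 ea0.
rewrite le_min => /andP[e'e e'a] x.
rewrite inE => /predU1P[->|xs]; last exact: (eP e' e'0 e'e).
move=> va; move: e'a; rewrite /ea va ler_pdivlMr// evD evZ => h.
have : e' * - ev u a <= e' * `|ev u a|.
  by rewrite ler_pM2l// -normrN ler_norm.
by rewrite mulrDr mulr1 mulrN in h *; lra.
Qed.

Lemma sumr_gt0_ex (I : finType) (P : pred I) (F : I -> R) :
  (exists i, P i) -> (forall i, P i -> 0 < F i) -> 0 < \sum_(i | P i) F i.
Proof.
move=> [i Pi] F0; rewrite (bigD1 i)//= ltr_pwDl ?F0// sumr_ge0// => j /andP[Pj _].
by rewrite ltW// F0.
Qed.

(* The separating functionals [V s] are linearly dependent; splitting a      *)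
(* dependency by signs, as in Radon's theorem, writes one functional in two  *)
(* ways as a positive combination of disjoint subfamilies.                   *)
Lemma avoid_radon B p : (d < #|` B|)%N ->
  (forall s, s \in B -> avoid (p |` (B `\ s))) -> avoid (p |` B).
Proof.
move=> dB avB.
have /choice[V VP] : forall s : B, exists v,
    forall x, x \in p |` (B `\ val s) -> 0 < ev v x.
  by move=> s; apply: avB; exact: valP.
have [|mu [[t0 mut0] mu0]] := @linear_dependence _ _ B V; first by rewrite -cardfE.
pose u := \sum_(s | 0 < mu s) mu s *: V s.
have uE : u = \sum_(s | mu s < 0) - mu s *: V s.
  apply/eqP; rewrite -subr_eq0 -[X in _ == X]mu0 /u.
  rewrite (bigID (fun s => 0 < mu s) predT)/=; apply/eqP; congr (_ + _).
  rewrite -sumrN (bigID (fun s => mu s < 0) (fun s => ~~ _))/= [X in _ = _ + X]big1.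
    rewrite addr0; apply: eq_big => [s|s _]; last by rewrite scaleNr opprK.
    by case: ltgtP.
  by move=> s; case: ltgtP => // <-; rewrite scale0r.
have uP x : (exists s, 0 < mu s) -> (forall s, 0 < mu s -> 0 < ev (V s) x) ->
    0 < ev u x.
  move=> exs VP0; rewrite /u /ev dot_suml; apply: sumr_gt0_ex => // s s0.
  by rewrite dotZl mulr_gt0// VP0.
have uN x : (exists s, mu s < 0) -> (forall s, mu s < 0 -> 0 < ev (V s) x) ->
    0 < ev u x.
  move=> exs VP0; rewrite uE /ev dot_suml; apply: sumr_gt0_ex => // s s0.
  by rewrite dotZl mulr_gt0 ?oppr_gt0// VP0.
have Vp s : 0 < ev (V s) p by apply: VP; rewrite fset1U1.
(* Were all coefficients of one sign, one expression for [u] would be an empty sum and the other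
   positive at [p]. *)
have exP : exists s, 0 < mu s.
  apply: contrapT => nP.
  have : 0 < ev u p.
    apply: uN => //; exists t0; rewrite lt_neqAle mut0 leNgt.
    by apply/negP => h; apply: nP; exists t0.
  rewrite /u big1 ?ev0 ?ltxx// => s s0.
  by case: nP; exists s.
have exN : exists s, mu s < 0.
  apply: contrapT => nN.
  have : 0 < ev u p by exact: uP.
  rewrite uE big1 ?ev0 ?ltxx// => s s0.
  by case: nN; exists s.
exists u => x; rewrite 2!inE => /predU1P[->|xB]; first exact: uP.
have VB s : x != fsval s -> 0 < ev (V s) x.
  by move=> sx; apply: VP; rewrite !inE sx xB orbT.
(* Only the form indexed by [x] itself may fail at [x], so [u] is expanded over the sign class that
   omits this index. *)
have [mx|mx] := leP (mu [` xB]) 0.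
  apply: uP => // s s0; apply: VB; apply: contraTneq s0 => sx.
  by rewrite -leNgt (_ : s = [` xB])//; apply: val_inj.
apply: uN => // s s0; apply: VB; apply: contraTneq s0 => sx.
by rewrite -leNgt (_ : s = [` xB]) ?ltW//; apply: val_inj.
Qed.

Lemma orthogonal_functional X : (#|` X| < d)%N ->
  exists2 v, v != 0 & forall x, x \in X -> ev v x = 0.
Proof.
move=> Xd; pose A := \matrix_(j < d, i < #|{: X}|) (val (enum_val i) - z) 0 j.
have [|v v0 vA] := @exists_left_kernel _ _ _ A.
  by apply: leq_ltn_trans (rank_leq_col _) _; rewrite -cardfE.
exists v => // x xX; have := congr1 (fun M : 'rV_ _ => M 0 (enum_rank [` xX])) vA.
rewrite !mxE => <-; apply: eq_bigr => j _.
by rewrite !mxE enum_rankK.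
Qed.

(** For at most [d] points, some nonzero form vanishes on all but one of them; up to sign it is
    nonnegative on [C], and tilting contradicts containment. *)
Lemma containing_card_ge S C :
  tiltable S -> C `<=` S -> ~ avoid C -> (d < #|` C|)%N.
Proof.
move=> tS CS nC; rewrite ltnNge; apply/negP => Cd; apply: nC.
have [->|[b bC]] := fset_0Vmem C; first by exists 0.
have [|v v0 vC] := @orthogonal_functional (C `\ b).
  by rewrite (leq_trans _ Cd)// [X in (_ < X)%N](cardfsD1 b) bC.
have vC0 x : x \in C -> x != b -> ev v x = 0 by move=> xC xb; rewrite vC// !inE xb.
have [vb|/ltW vb] := leP 0 (ev v b).
  apply: (tiltable_avoid tS CS v0) => x xC.
  by have [->//|/(vC0 _ xC)->] := eqVneq x b.
apply: (@tiltable_avoid _ _ (- v) tS CS) => [|x xC]; first by rewrite oppr_eq0.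
by rewrite evN oppr_ge0; have [->//|/(vC0 _ xC)->] := eqVneq x b.
Qed.

(** Steinitz's bound in the minimal case: with more than [d + 1] points, [avoid_radon] applies to
    one point [c] and the others. *)
Lemma min_containing_card_le C :
  ~ avoid C -> (forall c, c \in C -> avoid (C `\ c)) -> (#|` C| <= d.+1)%N.
Proof.
move=> nC minC; rewrite leqNgt; apply/negP => dC; apply: nC.
have [C0|[c cC]] := fset_0Vmem C; first by rewrite C0 cardfs0 in dC.
rewrite -(fsetD1K cC); apply: avoid_radon => [|s].
  by move: dC; rewrite (cardfsD1 c) cC add1n ltnS.
rewrite !inE => /andP[sc sC]; apply: avoidS (minC _ sC).
apply/fsubsetP => x; rewrite !inE => /predU1P[->|/and3P[-> _ ->]//].
by rewrite eq_sym sc.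
Qed.

(** * A linear program over the forms nonnegative on an avoiding set *)

Section Extremal.
Variables (S X : {fset 'rV[R]_d}) (p y : 'rV[R]_d).
Hypotheses (tS : tiltable S) (XS : X `<=` S) (pX : p \in X) (yS : y \in S).
Hypotheses (avX : avoid X) (nXy : ~ avoid (y |` X)).

(** The feasible region; the objective, to be maximized, is [ev v y]. *)
Let P v := ev v p = 1 /\ forall x, x \in X -> 0 <= ev v x.

Let P_y v : P v -> ev v y < 0.
Proof.
move=> [vp vX]; rewrite ltNge; apply/negP => vy; apply: nXy.
apply: (@tiltable_avoid S _ v) => //.
- by rewrite fsubUset fsub1set yS XS.
- exact: ev_eq1_neq0 vp.
- by move=> x; rewrite 2!inE => /predU1P[->//|/vX].
Qed.

Let P_normalize v : 0 < ev v p -> (forall x, x \in X -> 0 <= ev v x) ->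
  P ((ev v p)^-1 *: v).
Proof.
move=> vp vX; split=> [|x xX]; rewrite evZ ?mulVf ?gt_eqF//.
by rewrite mulr_ge0 ?invr_ge0 ?(ltW vp) ?vX.
Qed.

Let m := sup [set ev v y | v in P]%classic.

Let P_sup : has_sup [set ev v y | v in P]%classic.
Proof.
split; last by exists 0 => _ [v vP <-]; exact: ltW (P_y vP).
have [g gX] := avX; exists (ev ((ev g p)^-1 *: g) y).
exists ((ev g p)^-1 *: g) => //; apply: P_normalize; first exact: gX.
by move=> x /gX/ltW.
Qed.

Let P_le v : P v -> ev v y <= m.
Proof. by move=> vP; apply: ub_le_sup; [case: P_sup|exists v]. Qed.

(* A certificate that the optimum [m] is not attained would bound the        *)
(* objective away from [m].                                                  *)
Let P_max : exists2 v, P v & ev v y = m.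
Proof.
pose s := (true, p - z) :: (false, (y - z) - m *: (p - z)) ::
          [seq (false, x - z) | x <- X].
have [[v vs]|cone0] := motzkin s.
  have vp : 0 < ev v p by apply: (vs true); rewrite mem_head.
  have vy : 0 <= ev v y - m * ev v p.
    rewrite /ev -dotZr -dotNr -dotDr.
    by apply: (vs false); rewrite !inE eqxx orbT.
  have vX x : x \in X -> 0 <= ev v x.
    move=> xX; apply: (vs false); rewrite !inE; apply/orP; right; apply/orP; right.
    exact: (map_f (fun x => (false, x - z))).
  have nP := P_normalize vp vX; exists ((ev v p)^-1 *: v) => //.
  apply/eqP; rewrite eq_le (P_le nP) /= evZ ler_pdivlMl//.
  by rewrite mulrC -subr_ge0.
exfalso.
(* The certificate is evaluated at feasible forms: [t0] is the weight of the strict generator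
   [p - z], [t1] that of the objective, and the other terms are nonnegative. *)
have : exists t0 t1, [/\ 0 < t0, 0 <= t1 &
    forall w, P w -> t0 + t1 * (ev w y - m) <= 0].
  suff : forall b x, mixed_cone s b x -> exists t0 t1,
      [/\ pos_if b t0, 0 <= t1 &
      forall w, P w -> t0 + t1 * (ev w y - m) <= dot w x].
    move=> /(_ _ _ cone0)[t0 [t1 [t00 t10 h]]]; exists t0, t1; split=> // w /h.
    by rewrite dot0r.
  move=> b x; elim=> {b x} [|b x|b c x x' _ [t0 [t1 [t00 t10 h]]]
      _ [t0' [t1' [t00' t10' h']]]|k b x k0 _ [t0 [t1 [t00 t10 h]]]].
  - by exists 0, 0; split=> //= w _; rewrite dot0r mul0r addr0.
  - rewrite !inE => /or3P[/eqP[-> ->]|/eqP[-> ->]|/mapP[x' x'X [-> ->]]].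
    + exists 1, 0; split=> //=.
      by move=> w [wp _]; rewrite mul0r addr0 -wp.
    + exists 0, 1; split=> //= w [wp _]; rewrite dotDr dotNr dotZr.
      by rewrite -[dot w (p - z)]/(ev w p) wp add0r mul1r mulr1.
    + by exists 0, 0; split=> //= w [_ /(_ _ x'X)]; rewrite mul0r addr0.
  - exists (t0 + t0'), (t1 + t1'); split.
    + by move: b c t00 t00' => [] [] /=; lra.
    + by rewrite addr_ge0.
    + move=> w wP; rewrite dotDr; have := h _ wP; have := h' _ wP.
      by rewrite mulrDl; lra.
  - exists (k * t0), (k * t1); split.
    + by case: b t00 => /= h0; rewrite ?mulr_gt0 ?mulr_ge0// ltW.
    + by rewrite mulr_ge0 // ltW.
    + by move=> w wP; rewrite dotZr -mulrA -mulrDr ler_pM2l// h.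
move=> [t0 [t1 [t00 t10 h]]].
have [_ [w wP _]] := P_sup.1.
have {}t10 : 0 < t1.
  rewrite lt_neqAle t10 andbT; apply/negP => /eqP t1E.
  by have := h _ wP; rewrite -t1E mul0r addr0 leNgt t00.
have : m <= m - t0 / t1.
  apply: ge_sup; first exact: P_sup.1.
  move=> _ [w' w'P <-]; have := h _ w'P.
  rewrite -lerBrDl sub0r mulrC -ler_pdivlMr// mulNr; lra.
by rewrite lerBrDr gerDl leNgt divr_gt0.
Qed.

(** An optimal [v] works: a form [u] positive on the final set would make [v + e u], rescaled at
    [p], feasible with a larger value at [y], because the optimum [m] is negative. *)
Lemma extremal_functional : exists v, [/\ ev v p = 1,
  forall x, x \in X -> 0 <= ev v x, ev v y < 0 &
  ~ avoid (p |` (y |` [fset x in X | ev v x == 0]))].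
Proof.
have [v vP vm] := P_max; have [vp vX] := vP; have vy := P_y vP.
exists v; split=> // -[u uT].
have [e e0 eP] := small_perturbation u v X.
have up : 0 < ev u p by apply: uT; rewrite fset1U1.
have uy : 0 < ev u y by apply: uT; rewrite !inE eqxx orbT.
have wp : ev (v + e *: u) p = 1 + e * ev u p by rewrite evD evZ vp.
have eup : 0 < e * ev u p by rewrite mulr_gt0.
have euy : 0 < e * ev u y by rewrite mulr_gt0.
have wP : P ((ev (v + e *: u) p)^-1 *: (v + e *: u)).
  apply: P_normalize => [|x xX]; first by rewrite wp; lra.
  have := vX _ xX; rewrite le_eqVlt => /predU1P[v0|/(eP _ xX)/ltW//].
  rewrite evD evZ -v0 add0r mulr_ge0 ?(ltW e0)// ltW// uT//.
  by rewrite !inE xX -v0 eqxx !orbT.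
have := P_le wP; rewrite wp evZ ler_pdivrMl; last lra.
rewrite evD evZ vm mulrDl mul1r.
have : e * ev u p * m < 0 by rewrite pmulr_rlt0 // -vm.
lra.
Qed.

End Extremal.

End Separation.

(** * Convex hulls and interior points *)

Section ConvexHull.
Variables (R : realType) (d : nat).
Implicit Types (A B : set 'rV[R]_d) (x y w z : 'rV[R]_d) (t c : R).

Lemma convex_hull_sub A : (A `<=` convex_hull A)%classic.
Proof. exact: sub_smallest. Qed.

Lemma convex_hull_min A B :
    (forall t x y, 0 <= t -> t <= 1 -> B x -> B y -> B (t *: x + (1 - t) *: y)) ->
  (A `<=` B -> convex_hull A `<=` B)%classic.
Proof.
move=> cB AB; apply: smallest_sub => // x y l; rewrite !inE => Bx By.
by apply: cB.
Qed.

Lemma convex_hull_convex A t x y : 0 <= t -> t <= 1 ->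
  convex_hull A x -> convex_hull A y -> convex_hull A (t *: x + (1 - t) *: y).
Proof.
move=> t0 t1 Ax Ay B [cB AB].
have := cB x y (Itv01 t0 t1); rewrite !inE; apply.
  exact: Ax.
exact: Ay.
Qed.

Lemma convex_hull_mean A n (f : 'I_n.+1 -> 'rV[R]_d) :
  (forall i, convex_hull A (f i)) -> convex_hull A (n.+1%:R^-1 *: \sum_i f i).
Proof.
elim: n f => [|n IH] f fA; first by rewrite big_ord1 invr1 scale1r.
have n2 : n.+2%:R = n.+1%:R + 1 :> R by rewrite -natr1.
have n0 : (0 : R) < n.+1%:R by rewrite ltr0n.
have -> : n.+2%:R^-1 *: \sum_i f i = (n.+1%:R / n.+2%:R) *:
    (n.+1%:R^-1 *: \sum_(i < n.+1) f (widen_ord (leqnSn _) i)) +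
    (1 - n.+1%:R / n.+2%:R) *: f ord_max.
  rewrite big_ord_recr /= scalerDr scalerA; congr (_ *: _ + _ *: _).
    by rewrite n2; field; rewrite !gt_eqF//; lra.
  by rewrite n2; field; rewrite !gt_eqF//; lra.
apply: convex_hull_convex => //; last exact: IH.
by rewrite ler_pdivrMr ?ltr0n// mul1r n2; lra.
Qed.

Lemma convex_hull_ray A z w t c : convex_hull A z -> convex_hull A (z + t *: w) ->
  0 <= c -> c <= t -> convex_hull A (z + c *: w).
Proof.
move=> Az Aw c0; rewrite le_eqVlt => /predU1P[->//|ct].
have t0 : 0 < t by lra.
have -> : z + c *: w = (c / t) *: (z + t *: w) + (1 - c / t) *: z.
  apply/rowP => i; rewrite !mxE; field; rewrite gt_eqF//; lra.
apply: convex_hull_convex => //; first by rewrite divr_ge0// ltW.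
by rewrite ler_pdivrMr// mul1r ltW.
Qed.

Lemma uniform_lower_bound (T : eqType) (s : seq T) (f : T -> R) :
  (forall i, 0 < f i) -> exists2 e, 0 < e & forall i, i \in s -> e <= f i.
Proof.
move=> f0; elim: s => [|a s [e e0 eP]]; first by exists 1.
exists (Num.min e (f a)) => [|i]; first by rewrite lt_min e0 f0.
by rewrite inE ge_min => /predU1P[->|/eP->//]; rewrite lexx orbT.
Qed.

End ConvexHull.

(** The hull contains axis segments through [z] of a common half-length [e]. A point within [e / d]
    of [z] in the sup norm is the mean of [d] points on these segments. *)
Lemma interior_convex_hull (R : realType) d (A : set 'rV[R]_d) (z : 'rV[R]_d) :
    (0 < d)%N ->
    (forall w : 'rV[R]_d, w != 0 -> exists2 t : R, 0 < t & convex_hull A (z + t *: w)) ->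
  interior (convex_hull A) z.
Proof.
case: d A z => // n A z _ ray.
have e_neq0 (i : 'I_n.+1) : delta_mx 0 i != 0 :> 'rV[R]_n.+1.
  by apply/eqP => /rowP/(_ i)/eqP; rewrite !mxE !eqxx oner_eq0.
have Az : convex_hull A z.
  have [t t0 tA] := ray _ (e_neq0 ord0).
  have [|t' t'0 t'A] := ray (- delta_mx 0 ord0); first by rewrite oppr_eq0.
  have -> : z = (t' / (t + t')) *: (z + t *: delta_mx 0 ord0) +
      (1 - t' / (t + t')) *: (z + t' *: - delta_mx 0 ord0).
    by apply/rowP => i; rewrite !mxE; field; rewrite gt_eqF//; lra.
  apply: convex_hull_convex => //; first by rewrite divr_ge0; lra.
  by rewrite ler_pdivrMr; lra.
have [e e0 eP] : exists2 e : R, 0 < e & forall (i : 'I_n.+1) c, `|c| <= e ->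
    convex_hull A (z + c *: delta_mx 0 i).
  have /choice[tp tpP] (i : 'I_n.+1) : exists t : R, 0 < t /\
      convex_hull A (z + t *: delta_mx 0 i).
    by have [t] := ray _ (e_neq0 i); exists t.
  have /choice[tn tnP] (i : 'I_n.+1) : exists t : R, 0 < t /\
      convex_hull A (z + t *: - delta_mx 0 i).
    by have [|t] := ray (- delta_mx 0 i); [rewrite oppr_eq0|exists t].
  have [|e e0 eP] := @uniform_lower_bound R _ (enum 'I_n.+1)
      (fun i => Num.min (tp i) (tn i)).
    by move=> i; rewrite lt_min (tpP i).1 (tnP i).1.
  exists e => // i c ce; have := eP i; rewrite mem_enum le_min => /(_ isT)/andP[ep en].
  have [c0|c0] := leP 0 c.
    apply: (convex_hull_ray Az (tpP i).2 c0).
    by rewrite -(ger0_norm c0) (le_trans ce).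
  rewrite -[c]opprK scaleNr -scalerN.
  apply: (convex_hull_ray Az (tnP i).2); first by rewrite oppr_ge0 ltW.
  by rewrite -(ltr0_norm c0) (le_trans ce).
have n0 : (0 : R) < n.+1%:R by rewrite ltr0n.
apply/nbhs_ballP; exists (e / n.+1%:R) => /=; first by rewrite divr_gt0.
move=> y yz.
have -> : y = n.+1%:R^-1 *: \sum_i (z + (n.+1%:R * (y - z) 0 i) *: delta_mx 0 i).
  rewrite big_split /= sumr_const card_ord -[z *+ _]scaler_nat scalerDr scalerA.
  rewrite mulVf ?gt_eqF// scale1r -[LHS](subrK z) addrC; congr (_ + _).
  rewrite [LHS]row_sum_delta scaler_sumr; apply: eq_bigr => i _.
  by rewrite scalerA mulKf ?gt_eqF.
apply: convex_hull_mean => i; apply: eP.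
rewrite normrM gtr0_norm// mulrC -ler_pdivlMr// !mxE distrC.
by have [_ /(_ 0 i)] := yz; exact: ltW.
Qed.

(** * Containment and general position in terms of forms *)

Section Containing.
Variables (R : realType) (d : nat) (z : 'rV[R]_d).
Implicit Types (S X T : {fset 'rV[R]_d}).
Local Open Scope fset_scope.
Local Open Scope ring_scope.

Lemma z_containing_not_avoid X : z_containing z X -> ~ avoid z X.
Proof.
move=> /interior_subset zX [v vX].
have := @convex_hull_min _ _ [set` X] [set x | 0 < ev z v x]%classic.
move=> /(_ _ vX _ zX); rewrite /= /ev subrr dot0r ltxx.
suff h : forall t x y, 0 <= t -> t <= 1 -> 0 < dot v (x - z) ->
    0 < dot v (y - z) -> 0 < dot v (t *: x + (1 - t) *: y - z).
  by move=> /(_ h).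
move=> t x y t0 t1 vx vy.
have -> : t *: x + (1 - t) *: y - z = t *: (x - z) + (1 - t) *: (y - z).
  by apply/rowP => i; rewrite !mxE; ring.
rewrite dotDr !dotZr; have [->|t0'] := eqVneq t 0; first lra.
have {}t0 : 0 < t by rewrite lt_neqAle eq_sym t0'.
by rewrite ltr_pwDl ?mulr_gt0// mulr_ge0 ?subr_ge0// ltW.
Qed.

(** For each direction [w], either a form nonnegative on [X] and negative on [w] tilts to an
    avoiding one, or the Motzkin certificate gives a hull point on the ray from [z] along [w]. *)
Lemma not_avoid_z_containing S X : (0 < d)%N -> tiltable z S -> (X `<=` S)%fset ->
  ~ avoid z X -> z_containing z X.
Proof.
move=> d0 tS XS nX; apply: interior_convex_hull => // w w0.
have [X0|[x0 x0X]] := fset_0Vmem X; first by case: nX; exists 0; rewrite X0.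
pose s := (true, - w) :: [seq (false, x - z) | x <- X].
have [[v vs]|cone0] := motzkin s.
  have vw : 0 < dot v (- w) by apply: (vs true); rewrite mem_head.
  case: nX; apply: (tiltable_avoid (v := v) tS XS).
    by apply: contraTneq vw => ->; rewrite dot0l ltxx.
  move=> x xX; apply: (vs false); rewrite inE; apply/orP; right.
  exact: (map_f (fun x => (false, x - z))).
have : exists c l h, [/\ 0 < c, 0 <= l, convex_hull [set` X] h &
    0 = - (c *: w) + l *: (h - z)].
  suff : forall b x, mixed_cone s b x -> exists c l h,
      [/\ pos_if b c, 0 <= l, convex_hull [set` X] h &
          x = - (c *: w) + l *: (h - z)].
    by move=> /(_ _ _ cone0).
  have hx0 : convex_hull [set` X] x0 by exact: convex_hull_sub.
  move=> b x; elim=> {b x} [|b x|b b' x x' _ [c [l [h [c0 l0 hX ->]]]]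
      _ [c' [l' [h' [c0' l0' hX' ->]]]]|k b x k0 _ [c [l [h [c0 l0 hX ->]]]]].
  - by exists 0, 0, x0; split=> //=; rewrite !scale0r oppr0 addr0.
  - rewrite inE => /predU1P[[-> ->]|/mapP[x' x'X [-> ->]]].
      by exists 1, 0, x0; split=> //=; rewrite scale0r scale1r addr0.
    exists 0, 1, x'; split=> //=; first exact: convex_hull_sub.
    by rewrite scale0r scale1r oppr0 add0r.
  - have [ll0|ll0] := eqVneq (l + l') 0.
      have [-> ->] : l = 0 /\ l' = 0 by split; lra.
      exists (c + c'), 0, x0; split=> //.
        by move: b b' c0 c0' => [] [] /=; lra.
      by rewrite !scale0r !addr0 scalerDl opprD.
    have {}ll0 : 0 < l + l' by rewrite lt_neqAle eq_sym ll0 addr_ge0.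
    exists (c + c'), (l + l'), ((l / (l + l')) *: h + (1 - l / (l + l')) *: h').
    split; [|exact: ltW| |].
    + by move: b b' c0 c0' => [] [] /=; lra.
    + apply: convex_hull_convex => //; first by rewrite divr_ge0// ltW.
      by rewrite ler_pdivrMr//; lra.
    + by apply/rowP => i; rewrite !mxE; field; rewrite gt_eqF.
  - exists (k * c), (k * l), h; split=> //.
    + by case: b c0 => /= h0; rewrite ?mulr_gt0 ?mulr_ge0// ltW.
    + by rewrite mulr_ge0// ltW.
    + by apply/rowP => i; rewrite !mxE; ring.
move=> [c [l [h [c0 l0 hX]]]] /eqP; rewrite eq_sym addrC subr_eq0 => /eqP E.
have {}l0 : 0 < l.
  rewrite lt_neqAle l0 andbT; apply: contra_neqN w0 => /eqP l0E.
  by apply/eqP; move/eqP: E; rewrite -l0E scale0r eq_sym scaler_eq0 gt_eqF.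
exists (c / l); first by rewrite divr_gt0.
have -> : z + (c / l) *: w = h; last by [].
rewrite mulrC -scalerA -E scalerA mulVf ?gt_eqF// scale1r addrC subrK//.
Qed.

Lemma affine_hull_sub (A : set 'rV[R]_d) : (A `<=` affine_hull A)%classic.
Proof. exact: sub_smallest. Qed.

Lemma hyperplane_affine_hull_dim v T : v != 0 ->
  (forall x, x \in T -> ev z v x = 0) -> affine_dim (affine_hull [set` T]) < d%:Z.
Proof.
move=> v0 vT; have [->|[q [V hE]]] := affine_hull_affine [set` T].
  by rewrite affine_dim0 (@lt_le_trans _ _ 0).
rewrite hE affine_dim_translate ltz_nat.
pose K := lker (linfun (mulmxr v^T : 'rV[R]_d -> 'rV[R]_1)).
have KE x : (x \in K) = (dot v x == 0).
  rewrite memv_ker lfunE /=; apply/eqP/eqP => [/matrixP/(_ 0 0)|h].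
    by rewrite !mxE => <-; rewrite dotC; apply: eq_bigr => i _; rewrite mxE.
  apply/matrixP => i j; rewrite !ord1 !mxE -[RHS]h dotC.
  by apply: eq_bigr => k _; rewrite mxE.
have hK : (translate q V `<=` translate z K)%classic.
  rewrite -hE; apply: smallest_sub; first by right; exists z, K.
  by move=> x /= /vT vx; apply/mem_translate; rewrite KE; apply/eqP.
have VK : (V <= K)%VS.
  apply/subvP => x xV.
  have /mem_translate qK : translate z K q.
    by apply: hK; apply/mem_translate; rewrite subrr mem0v.
  have /mem_translate qxK : translate z K (q + x).
    by apply: hK; apply/mem_translate; rewrite addrC addKr.
  have -> : x = (q + x - z) - (q - z) by apply/rowP => i; rewrite !mxE; ring.
  exact: memvB.
apply: leq_ltn_trans (dimvS VK) _.
rewrite ltn_neqAle -[X in (_ <= X)%N](_ : \dim {: 'rV[R]_d} = d); last first.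
  by rewrite dimvf /dim /= mul1n.
rewrite dimvS ?subvf// andbT; apply: contra v0 => /eqP dK.
have KT : K = fullv.
  by apply/eqP; rewrite eqEdim subvf dK dimvf /dim /= mul1n.
by apply/eqP/dot_self_eq0/eqP; rewrite -KE KT memvf.
Qed.

(** All constraints are strict, so a Motzkin certificate normalizes to an affine combination of
    points of [T] equal to [z]. *)
Lemma avoid_affine_hull T : ~ affine_hull [set` T] z -> avoid z T.
Proof.
move=> nz; pose s := [seq (true, x - z) | x <- T].
have [[v vs]|cone0] := motzkin s.
  exists v => x xT; apply: (vs true).
  exact: (map_f (fun x => (true, x - z))).
suff : forall b x, mixed_cone s b x -> (b = false /\ x = 0) \/ exists c h,
    [/\ 0 < c, affine_hull [set` T] h & x = c *: (h - z)].
  move=> /(_ _ _ cone0)[[]//|[c [h [c0 hT /eqP]]]].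
  rewrite eq_sym scaler_eq0 gt_eqF//= subr_eq0 => /eqP hz.
  by case: nz; rewrite -hz.
have [hE|[q [V hE]]] := affine_hull_affine [set` T].
  move=> b x; elim=> {b x} [|b x /mapP[x' x'X [-> ->]]|b b' x x' _ + _|k b x _ _].
  - by left.
  - have : affine_hull [set` T] x' by exact: affine_hull_sub.
    by rewrite hE.
  - rewrite hE => -[[-> ->]|[? [? []//]]] [[-> ->]|[? [? []//]]].
    by left; rewrite addr0.
  - rewrite hE => -[[-> ->]|[? [? []//]]].
    by left; rewrite scaler0.
move=> b x; elim=> {b x} [|b x /mapP[x' x'X [-> ->]]|b b' x x' _ + _|k b x k0 _].
- by left.
- right; exists 1, x'; split=> //; last by rewrite scale1r.
  exact: affine_hull_sub.
- move=> [[-> ->]|[c [h [c0 hT ->]]]] [[-> ->]|[c' [h' [c0' hT' ->]]]].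
  + by left; rewrite addr0.
  + by right; exists c', h'; rewrite add0r.
  + by right; exists c, h; rewrite addr0.
  + right; exists (c + c'), ((c / (c + c')) *: h + (c' / (c + c')) *: h').
    have cc : c + c' != 0 by rewrite gt_eqF ?addr_gt0.
    split; [by rewrite addr_gt0| |by apply/rowP => i; rewrite !mxE; field].
    move: hT hT'; rewrite hE => /mem_translate hV /mem_translate hV'.
    apply/mem_translate; rewrite (_ : _ - q =
      (c / (c + c')) *: (h - q) + (c' / (c + c')) *: (h' - q)).
      by rewrite memvD// memvZ.
    by apply/rowP => i; rewrite !mxE; field.
- move=> [[-> ->]|[c [h [c0 hT ->]]]]; first by left; rewrite scaler0.
  by right; exists (k * c), h; rewrite mulr_gt0// scalerA.
Qed.

(** The points of [S] on the hyperplane of [v] have an affine hull missing [z], so some [u] is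
    positive on them; a small multiple of [u] is added to [v]. *)
Lemma general_position_tiltable S : general_position z S -> tiltable z S.
Proof.
move=> gS v v0; pose T := [fset s in S | ev z v s == 0]%fset.
have TS : (T `<=` S)%fset by apply/fsubsetP => s; rewrite !inE => /andP[].
have [|u uT] := @avoid_affine_hull T.
  apply: gS => //; apply: hyperplane_affine_hull_dim v0 _ => x.
  by rewrite !inE => /andP[_ /eqP].
have [e e0 eP] := small_perturbation z u v S.
exists (v + e *: u) => s sS; rewrite le_eqVlt => /predU1P[vs|]; last exact: eP.
by rewrite evD evZ -vs add0r mulr_gt0// uT// !inE sS -vs eqxx.
Qed.

Lemma z_containingP S X : (0 < d)%N -> general_position z S -> (X `<=` S)%fset ->
  z_containing z X <-> ~ avoid z X.
Proof.
move=> d0 /general_position_tiltable tS XS; split; first exact: z_containing_not_avoid.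
exact: not_avoid_z_containing tS XS.
Qed.

End Containing.

Lemma leq_card_bigfcup (I : eqType) (T : choiceType) (r : seq I)
    (F : I -> {fset T}) (k : nat) : (forall i, i \in r -> #|` F i| <= k)%N ->
  (#|` \bigcup_(i <- r) F i|%fset <= k * size r)%N.
Proof.
elim: r => [|a r IH] Fk; first by rewrite big_nil cardfs0.
rewrite big_cons mulnS (leq_trans (leq_card_fsetU _ _).1)// leq_add ?Fk ?mem_head//.
by apply: IH => i ir; rewrite Fk// inE ir orbT.
Qed.

Lemma in_fset_sep (T : choiceType) (A : {fset T}) (P : pred T) x :
  (x \in [fset y in A | P y]%fset) = (x \in A) && P x.
Proof. by rewrite !inE. Qed.

(** * Counting maximal avoiding and minimal containing sets under deletion *)

Section Families.
Variables (R : realType) (d : nat) (z : 'rV[R]_d).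
Hypothesis d_gt0 : (0 < d)%N.
Implicit Types (u v w x y p : 'rV[R]_d) (S X Y B C : {fset 'rV[R]_d}).
Local Open Scope fset_scope.
Local Open Scope ring_scope.

Lemma general_positionS S X :
  X `<=` S -> general_position z S -> general_position z X.
Proof. by move=> XS gS Y YX; apply: gS; exact: fsubset_trans YX XS. Qed.

Lemma z_avoidingP S X : general_position z S -> X `<=` S ->
  z_avoiding z X <-> avoid z X.
Proof.
move=> gS XS; rewrite /z_avoiding (z_containingP d_gt0 gS XS).
by split=> [/contrapT//|aX]; apply.
Qed.

Lemma max_avoidingP S X : general_position z S ->
  (X \in max_avoiding z S) <->
  [/\ X `<=` S, avoid z X & forall y, y \in S -> avoid z (y |` X) -> y \in X].
Proof.
move=> gS; rewrite !inE fpowersetE; split=> [/andP[XS /asboolP[aX maxX]]|].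
  split=> // [|y yS ay]; first exact/(z_avoidingP gS XS).
  have yXS : y |` X `<=` S by rewrite fsubUset fsub1set yS XS.
  rewrite -(maxX (y |` X)) ?fset1U1// ?fsubsetUr//.
  exact/(z_avoidingP gS yXS).
move=> [XS aX maxX]; rewrite XS /=; apply/asboolP; split.
  exact/(z_avoidingP gS XS).
move=> Y YS /(z_avoidingP gS YS) aY XY; apply/eqP; rewrite eqEfsubset XY andbT.
apply/fsubsetP => y yY; apply: maxX; first exact: (fsubsetP YS).
by apply: avoidS aY; rewrite fsubUset fsub1set yY.
Qed.

Lemma min_containingP S C : general_position z S ->
  (C \in min_containing z S) <->
  [/\ C `<=` S, ~ avoid z C & forall c, c \in C -> avoid z (C `\ c)].
Proof.
move=> gS; rewrite !inE fpowersetE; split=> [/andP[CS /asboolP[aC minC]]|].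
  split=> // [|c cC]; first exact/(z_containingP d_gt0 gS CS).
  have CcS : C `\ c `<=` S by exact: fsubset_trans (fsubsetDl _ _) CS.
  apply: contrapT => /(z_containingP d_gt0 gS CcS) nCc.
  have E := minC _ CcS nCc (fsubsetDl _ _).
  by move: cC; rewrite -E !inE eqxx.
move=> [CS aC minC]; rewrite CS /=; apply/asboolP; split.
  exact/(z_containingP d_gt0 gS CS).
move=> Y YS /(z_containingP d_gt0 gS YS) aY YC; apply/eqP; rewrite eqEfsubset YC /=.
apply/fsubsetP => c cC; apply: contrapT => /negP cY; apply: aY.
by apply: avoidS (minC _ cC); rewrite fsubsetD1 YC.
Qed.

Lemma exists_min_containing S X : general_position z S -> X `<=` S ->
  ~ avoid z X -> exists2 C, C \in min_containing z S & C `<=` X.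
Proof.
move=> gS; have [n] := ubnP #|` X|; elim: n X => // n IH X Xn XS nX.
have [[c [cX nXc]]|minX] := pselect (exists c, c \in X /\ ~ avoid z (X `\ c)).
  have XcX : X `\ c `<=` X by exact: fsubsetDl.
  have [||//|C CS CX] := IH (X `\ c).
  - by move: Xn; rewrite (cardfsD1 c) cX.
  - exact: fsubset_trans XcX XS.
  - by exists C => //; exact: fsubset_trans XcX.
exists X => //; apply/min_containingP => //; split=> // c cX.
by apply: contrapT => nXc; apply: minX; exists c.
Qed.

Definition facet_functional C p y v :=
  ev z v p = 1 /\ forall x, x \in C -> x != p -> x != y -> ev z v x = 0.

(** The difference of two such forms vanishes on [C] except perhaps at [y]; if nonzero, it could be
    tilted, up to sign, to be positive on [C]. *)
Lemma facet_functional_inj S C p y v w : tiltable z S -> C `<=` S ->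
    ~ avoid z C -> p \in C ->
  facet_functional C p y v -> facet_functional C p y w -> v = w.
Proof.
move=> tS CS nC pC [vp v0] [wp w0]; apply/eqP; apply: contrapT => /negP.
wlog vwy : v w vp v0 wp w0 / ev z w y <= ev z v y.
  move=> W vw; have [h|/ltW h] := leP (ev z w y) (ev z v y); first exact: (W v w).
  by apply: (W w v) => //; rewrite eq_sym.
rewrite -subr_eq0 => vw; apply: nC; apply: (tiltable_avoid tS CS vw) => x xC.
rewrite evD evN subr_ge0; have [->|xp] := eqVneq x p; first by rewrite vp wp.
by have [->//|xy] := eqVneq x y; rewrite v0// w0.
Qed.

Definition halfspace S v := [fset s in S | 0 <= ev z v s].

Section Deletion.
Variables (S : {fset 'rV[R]_d}) (p : 'rV[R]_d).
Hypotheses (gS : general_position z S) (pS : p \in S).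

Let tS : tiltable z S. Proof. exact: general_position_tiltable. Qed.

Let SpS : S `\ p `<=` S. Proof. by exact: fsubsetDl. Qed.

Let gSp : general_position z (S `\ p). Proof. exact: general_positionS gS. Qed.

(** A point [y] spoils the maximality of [X - p]. The set from [extremal_functional] contains a
    simplex [C]; it uses [p], since [y] with [X - p] is avoiding, and [y], since [X] is. Maximality
    of [X] makes it the whole closed half-space of [v]. *)
Lemma new_max_avoiding X : X \in max_avoiding z S -> p \in X ->
    X `\ p \notin max_avoiding z (S `\ p) ->
  exists C y v, [/\ C \in min_containing z S, p \in C & y \in C `\ p] /\
    [/\ facet_functional C p y v, ev z v y < 0, X = halfspace S v &
        avoid z (y |` (X `\ p))].
Proof.
move=> /(max_avoidingP _ gS)[XS aX maxX] pX nXp.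
have [y [yS yX ay]] : exists y,
    [/\ y \in S, y \notin X & avoid z (y |` (X `\ p))].
  apply: contrapT => ny; move/negP: nXp; apply; apply/(max_avoidingP _ gSp); split.
  - by rewrite fsetSD.
  - by apply: avoidS aX; exact: fsubsetDl.
  - move=> y; rewrite !inE => /andP[-> yS] ay /=; apply: contrapT => /negP yX.
    by apply: ny; exists y.
have nXy : ~ avoid z (y |` X) by move=> /(maxX _ yS); rewrite (negPf yX).
have [v [vp vX vy nT]] := extremal_functional tS XS pX yS aX nXy.
have v0 : v != 0 by exact: ev_eq1_neq0 vp.
have TyX : p |` (y |` [fset x in X | ev z v x == 0]) `<=` y |` X.
  apply/fsubsetP => x; rewrite !inE => /or3P[/eqP->|->//|/andP[-> _]].
    by rewrite pX orbT.
  by rewrite orbT.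
have yXS : y |` X `<=` S by rewrite fsubUset fsub1set yS XS.
have [C Cmin CT] := exists_min_containing gS (fsubset_trans TyX yXS) nT.
have CyX := fsubset_trans CT TyX.
have [CS nC _] := (min_containingP _ gS).1 Cmin.
have pC : p \in C.
  apply: contrapT => /negP pC; apply: nC; apply: avoidS ay.
  apply/fsubsetP => x xC; have := fsubsetP CyX _ xC.
  rewrite !inE => /orP[->//|->]; rewrite andbT orbC.
  by apply/orP; left; apply: contraNneq pC => <-.
have yC : y \in C.
  apply: contrapT => /negP yC; apply: nC; apply: avoidS aX.
  apply/fsubsetP => x xC; have := fsubsetP CyX _ xC.
  by rewrite !inE => /predU1P[xy|//]; rewrite -xy xC in yC.
exists C, y, v; split; first split=> //.
  by rewrite !inE yC andbT; apply: contraNneq yX => ->.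
split=> //.
  split=> // x xC xp xy; have := fsubsetP CT _ xC.
  by rewrite !inE (negPf xp) (negPf xy) /= => /andP[_ /eqP].
apply/eqP; rewrite eqEfsubset; apply/andP; split; apply/fsubsetP => x.
  by move=> xX; rewrite !inE (fsubsetP XS)//= vX.
rewrite !inE => /andP[xS vx]; apply: maxX => //.
apply: (tiltable_avoid tS _ v0) => [|x']; first by rewrite fsubUset fsub1set xS.
by rewrite !inE => /predU1P[->//|/vX].
Qed.

(* Let [B] be a simplex of [S `\ p] and [s] a vertex such that the opposite   *)
(* facet together with [p] is again a simplex [C]. A half-space that contains *)
(* [p] but not [y], with the rest of [C] on its boundary, contains [s], so    *)
(* with [y] it recovers all of [B].                                           *)
Lemma unused_simplex : ~ avoid z (S `\ p) ->
  exists C, [/\ C \in min_containing z S, p \in C &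
    forall y v, y \in C `\ p -> facet_functional C p y v -> ev z v y < 0 ->
      ~ avoid z (y |` (halfspace S v `\ p))].
Proof.
move=> nSp; have [B Bmin _] := exists_min_containing gSp (fsubset_refl _) nSp.
have [BSp nB minB] := (min_containingP _ gSp).1 Bmin.
have BS := fsubset_trans BSp SpS.
have pB : p \notin B by apply/negP => /(fsubsetP BSp); rewrite !inE eqxx.
have dB : (d < #|` B|)%N by exact: containing_card_ge tS BS nB.
have Bd : (#|` B| <= d.+1)%N by exact: min_containing_card_le nB minB.
(* If every exchange of a vertex for [p] gave an avoiding set, [avoid_radon] would make [B]
   avoiding. *)
have [s [sB ns]] : exists s, s \in B /\ ~ avoid z (p |` (B `\ s)).
  apply: contrapT => h; apply: nB.
  apply: (@avoidS _ _ _ _ (p |` B)); first exact: fsubsetU1.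
  apply: avoid_radon dB _ => s sB; apply: contrapT => ns; apply: h.
  by exists s.
have BpS : p |` (B `\ s) `<=` S.
  by rewrite fsubUset fsub1set pS (fsubset_trans (fsubsetDl _ _) BS).
have [C Cmin CB] := exists_min_containing gS BpS ns.
have [CS nC minC] := (min_containingP _ gS).1 Cmin.
have CE : C = p |` (B `\ s).
  apply/eqP; rewrite eqEfcard CB (leq_trans _ (containing_card_ge tS CS nC))//.
  rewrite cardfsU1 !inE (negPf pB) andbF /= add1n ltnS.
  by move: Bd; rewrite (cardfsD1 s) sB.
exists C; split=> // [|y v yC [vp v0] vy]; first by rewrite CE fset1U1.
move=> /(@avoidS _ _ _ B) aB; apply: (nB); apply: aB.
(* Otherwise [- v] is nonnegative on [B]. *)
have vs : 0 <= ev z v s.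
  rewrite leNgt; apply/negP => vs; apply: nB.
  have nv0 : - v != 0 by rewrite oppr_eq0; exact: ev_eq1_neq0 vp.
  apply: (tiltable_avoid tS BS nv0) => x xB; rewrite evN oppr_ge0.
  have [->|xs] := eqVneq x s; first exact: ltW.
  have [->|xy] := eqVneq x y; first exact: ltW.
  rewrite v0//; first by rewrite CE !inE xs xB orbT.
  by apply: contraNneq pB => <-.
apply/fsubsetP => x xB; rewrite !inE (fsubsetP BS)//=.
have xp : x != p by apply: contraNneq pB => <-.
rewrite xp /=; have [->|xy] //= := eqVneq x y.
have [->|xs] := eqVneq x s; first exact: vs.
by rewrite v0// CE !inE xs xB orbT.
Qed.

Lemma max_avoiding_deletion : ~ avoid z (S `\ p) ->
  (#|` max_avoiding z S| + d <= #|` max_avoiding z (S `\ p)| +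
    d * #|` [fset C in min_containing z S | p \in C]|)%N.
Proof.
move=> nSp; have [C0 [C0min pC0 C0P]] := unused_simplex nSp.
pose A := max_avoiding z S; pose A' := max_avoiding z (S `\ p).
pose Cp := [fset C in min_containing z S | p \in C].
pose E := [fset X in A | (p \in X) && (X `\ p \notin A')].
have C0Cp : C0 \in Cp by rewrite in_fset_sep C0min.
have EC : (#|` E| <= d * #|` Cp `\ C0|)%N.
  (* By uniqueness the chosen form is the actual one whenever one exists; the default [0] only adds
     harmless values to the image. *)
  pose f C y := halfspace S (xget 0 [set v | facet_functional C p y v]%classic).
  have fP C y v : C \in Cp -> facet_functional C p y v -> f C y = halfspace S v.
    rewrite in_fset_sep => /andP[/(min_containingP _ gS)[CS nC _] pC] vP.
    rewrite /f; congr halfspace; apply: (facet_functional_inj tS CS nC pC _ vP).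
    by case: xgetP => [w _ //|/(_ v)].
  have : E `<=` \bigcup_(C <- Cp `\ C0) [fset f C y | y in C `\ p].
    apply/fsubsetP => X; rewrite in_fset_sep => /andP[XA /andP[pX XpA]].
    have [C [y [v [[Cmin pC yC] [vP vy XE aXy]]]]] := new_max_avoiding XA pX XpA.
    have CCp : C \in Cp by rewrite in_fset_sep Cmin.
    apply/bigfcupP; exists C; last first.
      by apply/imfsetP; exists y => //=; rewrite (fP _ _ _ CCp vP).
    rewrite andbT in_fsetD1 CCp andbT; apply/eqP => CC0.
    rewrite CC0 in yC vP; apply: (C0P y v yC vP vy).
    by rewrite -XE.
  move=> /fsubset_leq_card/leq_trans; apply; apply: leq_card_bigfcup => C.
  rewrite in_fsetD1 => /andP[_]; rewrite in_fset_sep => /andP[/(min_containingP _ gS)].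
  move=> [CS nC minC] pC; apply: leq_trans (leq_imfset_card _ _ _) _.
  have := min_containing_card_le nC minC.
  by rewrite (cardfsD1 p) pC.
have AE : (#|` A `\` E| <= #|` A'|)%N.
  (* Two members with equal restriction could differ only by [p], and then the smaller would not be
     maximal. *)
  have injD : {in A `\` E &, injective (fun X => X `\ p)}.
    have key X Y : X \in A -> Y \in A -> X `\ p = Y `\ p -> p \in X -> p \in Y.
      move=> /(max_avoidingP _ gS)[_ aX _] /(max_avoidingP _ gS)[_ _ maxY] XY pX.
      apply: maxY => //; apply: avoidS aX; apply/fsubsetP => x.
      rewrite !inE => /predU1P[->//|xY]; have [->//|xp] := eqVneq x p.
      have : x \in Y `\ p by rewrite !inE xp.
      by rewrite -XY !inE => /andP[].
    move=> X Y; rewrite !in_fsetD => /andP[_ XA] /andP[_ YA] XY.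
    apply/fsetP => x; have [->|xp] := eqVneq x p.
      by apply/idP/idP; apply: key.
    by move/fsetP/(_ x): XY; rewrite !inE xp.
  rewrite -(card_in_imfset imfset_key injD); apply: fsubset_leq_card.
  apply/fsubsetP => _ /imfsetP[X /= XAE ->].
  move: XAE; rewrite in_fsetD in_fset_sep => /andP[XE XA].
  move: XE; rewrite XA /= negb_and negbK => /orP[pX|//].
  have XE : X `\ p = X by apply/fsetP => x; rewrite !inE; case: eqVneq => [->|//];
    rewrite (negPf pX).
  rewrite XE; have [XS aX maxX] := (max_avoidingP _ gS).1 XA.
  apply/(max_avoidingP _ gSp); split=> // [|y]; first by rewrite fsubsetD1 XS.
  by rewrite !inE => /andP[_]; exact: maxX.
have EA : E `<=` A by apply/fsubsetP => X; rewrite in_fset_sep => /andP[].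
have cA : #|` A| = (#|` E| + #|` A `\` E|)%N.
  by rewrite cardfsDS// subnKC// fsubset_leq_card.
move: EC; rewrite -/A -/A' -/Cp [#|` Cp|](cardfsD1 C0) C0Cp cA.
by rewrite mulnDr muln1; lia.
Qed.

Lemma min_containing_deletion : #|` min_containing z S| =
  (#|` min_containing z (S `\ p)| +
   #|` [fset C in min_containing z S | p \in C]|)%N.
Proof.
set Cp := [fset C in _ | _].
have CpS : Cp `<=` min_containing z S by apply/fsubsetP => X; rewrite in_fset_sep => /andP[].
rewrite -(subnK (fsubset_leq_card CpS)) -cardfsDS//; congr (#|` _| + _)%N.
apply/fsetP => C; rewrite in_fsetD in_fset_sep; apply/idP/idP.
  move=> /andP[+ Cmin]; rewrite Cmin /= => pC.
  have [CS nC minC] := (min_containingP _ gS).1 Cmin.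
  by apply/(min_containingP _ gSp); split=> //; rewrite fsubsetD1 CS.
move=> /(min_containingP _ gSp)[CSp nC minC].
rewrite negb_and (_ : p \notin C) ?orbT /=.
  by apply/(min_containingP _ gS); split=> //; exact: fsubset_trans SpS.
by apply/negP => /(fsubsetP CSp); rewrite !inE eqxx.
Qed.

End Deletion.

(** An additive form free of truncated subtraction, in which each deletion step loses exactly [d] on
    the left through the size of [S]. *)
Lemma max_avoiding_bound S : general_position z S -> ~ avoid z S ->
  (#|` max_avoiding z S| + d * #|` S| <=
   d.+1 + d * d + d * #|` min_containing z S|)%N.
Proof.
have [n] := ubnP #|` S|; elim: n S => // n IH S Sn gS nS.
have [[p [pS nSp]]|minS] := pselect (exists p, p \in S /\ ~ avoid z (S `\ p)).
  have SpS : S `\ p `<=` S by exact: fsubsetDl.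
  have cS : #|` S| = #|` S `\ p|.+1 by rewrite (cardfsD1 p) pS.
  have := IH (S `\ p); rewrite -ltnS -cS => /(_ Sn (general_positionS SpS gS) nSp).
  have := max_avoiding_deletion gS pS nSp; rewrite (min_containing_deletion p gS).
  by rewrite cS mulnS mulnDr; lia.
have {}minS p : p \in S -> avoid z (S `\ p).
  by move=> pS; apply: contrapT => nSp; apply: minS; exists p.
have Sd := min_containing_card_le nS minS.
have C_gt0 : (0 < #|` min_containing z S|)%N.
  rewrite cardfs_gt0; apply/fset0Pn; exists S.
  exact/min_containingP.
(* Here [S] is minimal containing, so its maximal avoiding subsets omit a single point. *)
have AS : (#|` max_avoiding z S| <= #|` S|)%N.
  apply: (@leq_trans #|` [fset S `\ p | p in S]|); last exact: leq_imfset_card.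
  apply: fsubset_leq_card; apply/fsubsetP => X /(max_avoidingP _ gS)[XS aX maxX].
  have [p pS pX] : exists2 p, p \in S & p \notin X.
    apply/fsubsetPn; apply/negP => SX; apply: nS.
    exact: avoidS aX.
  apply/imfsetP; exists p => //=; apply/fsetP => x; rewrite !inE.
  have XSp : X `<=` S `\ p by rewrite fsubsetD1 XS.
  apply/idP/idP => [/(fsubsetP XSp)|/andP[xp xS]]; first by rewrite !inE.
  apply: maxX => //; apply: avoidS (minS _ pS).
  by rewrite fsubUset fsub1set !inE xp xS XSp.
nia.
Qed.

End Families.

Theorem theorem3p5 (R : realType) (d : nat) (S : {fset 'rV[R]_d})
    (z : 'rV[R]_d)
    (z_notin_S : z \notin S)
    (S_containing : z_containing z S)
    (z_general : general_position z S)
    (card_S : (d + 2 <= #|` S|)%N) :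
  (#|` max_avoiding z S|)%:Z
    <= d%:Z * (#|` min_containing z S|)%:Z - (#|` S|)%:Z + 3.
Proof.
(* In dimension 0 there is only one point, so a nonempty [S] would contain [z]. *)
have d_gt0 : (0 < d)%N.
  rewrite lt0n; apply/negP => /eqP d0; subst d.
  have [S0|[s sS]] := fset_0Vmem S; first by rewrite S0 cardfs0 in card_S.
  by move/negP: z_notin_S; apply; rewrite (_ : z = s)//; apply/rowP => -[].
have := max_avoiding_bound d_gt0 z_general (z_containing_not_avoid S_containing).
(* The bound just obtained is sharper than the goal by [(d - 1) (|S| - d - 2)], nonnegative by
   [card_S]. *)
nia.
Qed.
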